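(* For every $\epsilon>0$, there is no weak consistent digital ray system (WCDR) in $\mathbb{Z}^2$ whose error in the $L_\infty$ metric is at most $1.5-\epsilon$.
   Context: Consider the unit grid graph on $\mathbb{Z}^2$: two points $p=(p_x,p_y)$, $q=(q_x,q_y)$ are adjacent iff $|p_x-q_x|+|p_y-q_y|=1$. Fix a root $o\in\mathbb{Z}^2$. A digital ray system $R_o$ assigns to every $p\in\mathbb{Z}^2$ a set $R_o(p)\subseteq\mathbb{Z}^2$. It is a weak consistent digital ray system (WCDR) if: (S1) for every $p$, $R_o(p)$ is the vertex set of a path from $o$ to $p$ in the grid graph; (S3) for every $p$ and every $q\in R_o(p)$, $R_o(q)\subseteq R_o(p)$; (S5) for every $p$, if $p_x=o_x$ then every $r\in R_o(p)$ has $r_x=o_x$, and if $p_y=o_y$ then every $r\in R_o(p)$ has $r_y=o_y$. The error of a segment is $E(R_o(p))=\max_{v\in R_o(p)} \mathrm{dist}_\infty(v,\overline{op})$, where $\overline{op}$ is the Euclidean segment from $o$ to $p$ and $\mathrm{dist}_\infty$ denotes $L_\infty$ distance from a point to a set. The error of the WCDR is $\sup_{p\in\mathbb{Z}^2}E(R_o(p))$. *)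

(* Defs.v *)
From Stdlib Require Import Reals ZArith List Lra Lia.
From Coquelicot Require Import Coquelicot.
Import ListNotations.
Open Scope R_scope.

Definition pt := (Z * Z)%type.

Definition adj (p q : pt) : Prop :=
  (Z.abs (fst p - fst q) + Z.abs (snd p - snd q) = 1)%Z.

Fixpoint chain (l : list pt) : Prop :=
  match l with
  | x :: ((y :: _) as t) => adj x y /\ chain t
  | _ => True
  end.

Definition is_path (l : list pt) (a b : pt) : Prop :=
  NoDup l /\ chain l /\ head l = Some a /\ last l a = b /\ l <> [].

(* a digital ray system: to every p a set R_o(p) of grid points *)
Definition ray_system := pt -> pt -> Prop.

Definition S1 (o : pt) (R : ray_system) : Prop :=
  forall p, exists l, is_path l o p /\ forall v, R p v <-> In v l.

Definition S3 (R : ray_system) : Prop :=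
  forall p q, R p q -> forall r, R q r -> R p r.

Definition S5 (o : pt) (R : ray_system) : Prop :=
  forall p,
    (fst p = fst o -> forall r, R p r -> fst r = fst o) /\
    (snd p = snd o -> forall r, R p r -> snd r = snd o).

Definition WCDR (o : pt) (R : ray_system) : Prop := S1 o R /\ S3 R /\ S5 o R.

Definition linf_to_seg_pt (o p v : pt) (t : R) : R :=
  Rmax (Rabs (IZR (fst v) - (IZR (fst o) + t * (IZR (fst p) - IZR (fst o)))))
       (Rabs (IZR (snd v) - (IZR (snd o) + t * (IZR (snd p) - IZR (snd o))))).

Definition dist_seg (o p v : pt) : Rbar :=
  Glb_Rbar (fun d => exists t, 0 <= t <= 1 /\ d = linf_to_seg_pt o p v t).

Definition seg_error (o : pt) (R : ray_system) (p : pt) : Rbar :=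
  Lub_Rbar (fun d => exists v, R p v /\ dist_seg o p v = Finite d).

Definition sys_error (o : pt) (R : ray_system) : Rbar :=
  Lub_Rbar (fun d => exists p, seg_error o R p = Finite d).

(* Main.v *)
(* Taking for the parent of p its predecessor on R_o(p) gives a tree whose ancestor sets are contained in the rays.
   Suppose the error is at most 3/2 - eps and look at rays to far points of small slope, where the error is
   essentially vertical.  If two vertices of one column at vertical distance at least 2 both descend from both ends
   of a slightly earlier vertical edge, adding their two error bounds gives 3 <= 2 (3/2 - eps) up to o(1).  Hence a column contains
   at most two descendants of a recent vertical edge, which leaves no room for a branching both sides of which
   continue to climb, as soon as the branching is at a height large compared to 1/eps.  But the rays to many points
   of one high row must pass through a column with fewer admissible rows, so two of them branch after that column. *)
Require Import Defs.
From Stdlib Require Import Reals ZArith List Lra Lia Classical IndefiniteDescription Wf_nat.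
From Coquelicot Require Import Coquelicot.
Import ListNotations.
Open Scope Z_scope.

(** * Ancestor walks and the columns and rows they cross *)

Definition anc (par : pt -> pt) (p v : pt) : Prop := exists n, Nat.iter n par p = v.

(* The integer consequences of [v] being within L_infinity distance 3/2 - 1/N of the segment from (0,0) to [p]. *)
Definition close (N : Z) (p v : pt) : Prop :=
  2 * N * Z.abs (snd v * fst p - fst v * snd p)
    <= (3 * N - 2) * (Z.abs (fst p) + Z.abs (snd p)) /\
  fst v <= Z.max (fst p) 0 + 1 /\
  Z.min (snd p) 0 - 1 <= snd v <= Z.max (snd p) 0 + 1.

(** The bound [<= 1] instead of an equality lets the root be its own parent. *)
Definition ray_tree (N : Z) (par : pt -> pt) : Prop :=
  (forall p, Z.abs (fst (par p) - fst p) + Z.abs (snd (par p) - snd p) <= 1) /\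
  (forall p, exists n, Nat.iter n par p = (0, 0)) /\
  (forall p v, anc par p v -> close N p v).

Lemma anc_iter par p n : anc par p (Nat.iter n par p).
Proof. now exists n. Qed.

Lemma anc_trans par p q r : anc par p q -> anc par q r -> anc par p r.
Proof. intros [n <-] [m <-]; exists (m + n)%nat; apply Nat.iter_add. Qed.

Lemma anc_iter_le par p i n :
  (i <= n)%nat -> anc par (Nat.iter i par p) (Nat.iter n par p).
Proof.
  intros H; exists (n - i)%nat; rewrite <- Nat.iter_add; f_equal; lia.
Qed.

Lemma nat_switch (P : nat -> Prop) N :
  P 0%nat -> ~ P N -> exists k, (k < N)%nat /\ P k /\ ~ P (S k).
Proof.
  induction N as [|N IH]; intros H0 HN; [easy|].
  destruct (classic (P N)) as [H|H].
  - now exists N; repeat split; auto.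
  - destruct (IH H0 H) as [k [Hk HP]]; exists k; split; [lia | easy].
Qed.

Lemma least_nat (P : nat -> Prop) :
  (exists n, P n) -> exists n, P n /\ forall k, (k < n)%nat -> ~ P k.
Proof.
  intros [n Hn]; revert Hn; induction n as [n IH] using lt_wf_ind; intros Hn.
  destruct (classic (exists k, (k < n)%nat /\ P k)) as [[k [Hk HP]]|H].
  - exact (IH k Hk HP).
  - exists n; split; [exact Hn | intros k Hk HP; apply H; eauto].
Qed.

(** Discrete intermediate values: a step changes the abscissa by at most one. *)
Lemma column_hit N par p n c :
  ray_tree N par -> fst (Nat.iter n par p) <= c <= fst p ->
  exists k, (k <= n)%nat /\ fst (Nat.iter k par p) = c.
Proof.
  intros [Hs _] H.
  destruct (Z.eq_dec (fst (Nat.iter n par p)) c) as [E|E]; [now exists n|].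
  destruct (nat_switch (fun k => c <= fst (Nat.iter k par p)) n) as [k [Hk [H1 H2]]];
    [simpl; lia | lia |].
  exists k; split; [lia|].
  specialize (Hs (Nat.iter k par p)); simpl in H2; lia.
Qed.

(** A step that changes the row has no length left for a horizontal move. *)
Lemma row_leave N par p n b :
  ray_tree N par -> snd p = b -> snd (Nat.iter n par p) <> b ->
  exists k, (k < n)%nat /\ snd (Nat.iter k par p) = b /\
    Z.abs (snd (Nat.iter (S k) par p) - b) = 1 /\
    fst (Nat.iter (S k) par p) = fst (Nat.iter k par p).
Proof.
  intros [Hs _] H0 Hn.
  destruct (nat_switch (fun k => snd (Nat.iter k par p) = b) n) as [k [Hk [H1 H2]]];
    [easy | easy |].
  exists k; specialize (Hs (Nat.iter k par p)); simpl in H2 |- *; lia.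
Qed.

Lemma row_enter N par p n b :
  ray_tree N par -> snd p <> b -> snd (Nat.iter n par p) = b ->
  exists k, (k < n)%nat /\ snd (Nat.iter k par p) <> b /\
    snd (Nat.iter (S k) par p) = b /\
    fst (Nat.iter (S k) par p) = fst (Nat.iter k par p).
Proof.
  intros [Hs _] H0 Hn.
  destruct (nat_switch (fun k => snd (Nat.iter k par p) <> b) n) as [k [Hk [H1 H2]]];
    [easy | now intros H |].
  exists k; specialize (Hs (Nat.iter k par p)); simpl in H2 |- *; lia.
Qed.

(** * Descendants of a vertical edge within one column *)

Definition below_edge (par : pt -> pt) (c a : Z) (q : pt) : Prop :=
  anc par q (c, a) /\ anc par q (c, a + 1).

Lemma below_edge_anc par c a p q :
  anc par p q -> below_edge par c a q -> below_edge par c a p.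
Proof. intros H [H1 H2]; split; eapply anc_trans; eauto. Qed.

(* Adding the two slope constraints gives [x + 2c <= 2E x + O(h)], and [2E < 3]. *)
Lemma column_narrow N par c a x h u v :
  ray_tree N par -> 1 <= N -> 0 <= c -> 0 <= h ->
  2 * N * (h + 2) < x -> 4 * N * x <= 4 * N * c + x + 6 * N ->
  fst u = x -> fst v = x -> -1 <= snd u <= h + 1 -> -1 <= snd v <= h + 1 ->
  below_edge par c a u -> below_edge par c a v -> snd v <= snd u + 1.
Proof.
  intros [_ [_ Hc]] HN Hc0 Hh Hx Hcx Hu Hv Hur Hvr [_ Hu2] [Hv1 _].
  destruct (Z_le_gt_dec (snd v) (snd u + 1)) as [|Hgt]; [easy|exfalso].
  assert (Hx0 : 0 <= x) by (pose proof (Z.mul_nonneg_nonneg (2 * N) (h + 2)); lia).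
  (* The lower vertex is tested against the upper end of the edge and the upper vertex against the
     lower end, so the length of the edge adds to the gap between the vertices. *)
  destruct (Hc u _ Hu2) as [Eu _], (Hc v _ Hv1) as [Ev _].
  cbn [fst snd] in Eu, Ev; rewrite Hu, (Z.abs_eq x) in Eu by lia; rewrite Hv, (Z.abs_eq x) in Ev by lia.
  assert (L : forall t y, -1 <= y <= h + 1 ->
            2 * N * Z.abs t <= (3 * N - 2) * (x + Z.abs y) ->
            2 * N * t <= (3 * N - 2) * (x + (h + 1))).
  { intros t y Hy Ht.
    assert (2 * N * t <= 2 * N * Z.abs t) by (apply Z.mul_le_mono_nonneg_l; lia).
    assert ((3 * N - 2) * (x + Z.abs y) <= (3 * N - 2) * (x + (h + 1)))
      by (apply Z.mul_le_mono_nonneg_l; lia).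
    lia. }
  pose proof (L _ _ Hur Eu) as A1.
  rewrite <- Z.abs_opp in Ev; pose proof (L _ _ Hvr Ev) as A2.
  assert (A3 : 2 * N * c * (snd u + 2) <= 2 * N * c * snd v)
    by (apply Z.mul_le_mono_nonneg_l; [apply Z.mul_nonneg_nonneg|]; lia).
  (* The bounds combine to [3 x <= 6 N (h + 2) - 4 (h + 1)], against [2 N (h + 2) < x]. *)
  lia.
Qed.

(** Three integers pairwise at distance at most one cannot all differ. *)
Lemma column_at_most_two N par c a x h u v w :
  ray_tree N par -> 1 <= N -> 0 <= c -> 0 <= h ->
  2 * N * (h + 2) < x -> 4 * N * x <= 4 * N * c + x + 6 * N ->
  (forall r, In r [u; v; w] ->
     fst r = x /\ -1 <= snd r <= h + 1 /\ below_edge par c a r) ->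
  u <> v -> u <> w -> v <> w -> False.
Proof.
  intros HT HN Hc Hh Hx Hcx H Huv Huw Hvw.
  assert (K : forall r s, In r [u; v; w] -> In s [u; v; w] -> snd r <= snd s + 1).
  { intros r s Hr Hs; destruct (H r Hr) as [R1 [R2 R3]], (H s Hs) as [S1 [S2 S3]].
    eapply (column_narrow N par c a x h); eauto. }
  assert (D : forall r s, In r [u; v; w] -> In s [u; v; w] -> r <> s -> snd r <> snd s).
  { intros r s Hr Hs Hrs E; apply Hrs.
    destruct (H r Hr) as [R1 _], (H s Hs) as [S1 _], r, s; simpl in *; congruence. }
  assert (Iu : In u [u; v; w]) by (simpl; auto).
  assert (Iv : In v [u; v; w]) by (simpl; auto).
  assert (Iw : In w [u; v; w]) by (simpl; auto).
  generalize (D u v Iu Iv Huv) (D u w Iu Iw Huw) (D v w Iv Iw Hvw)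
    (K u v Iu Iv) (K v u Iv Iu) (K u w Iu Iw) (K w u Iw Iu) (K v w Iv Iw) (K w v Iw Iv).
  lia.
Qed.

(* Two vertices on the same row, one an ancestor of the other, are close: else the later one drifts off the ray. *)
Lemma row_run_short N par x b c :
  ray_tree N par -> 1 <= N -> 6 * N <= b -> 0 <= x ->
  anc par (x, b) (c, b) -> 4 * N * x <= 4 * N * c + x + 6 * N.
Proof.
  intros [_ [_ Hc]] HN Hb Hx Ha.
  destruct (Hc _ _ Ha) as [E _]; cbn [fst snd] in E.
  assert (A : 2 * N * (b * (x - c)) <= 3 * N * (x + b)).
  { assert (2 * N * (b * (x - c)) <= 2 * N * Z.abs (b * x - c * b))
      by (apply Z.mul_le_mono_nonneg_l; lia).
    rewrite (Z.abs_eq b), (Z.abs_eq x) in E by lia.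
    set (m := Z.abs (b * x - c * b)) in *; clearbody m; lia. }
  assert (A' : 2 * (b * (x - c)) <= 3 * (x + b))
    by (apply (Z.mul_le_mono_pos_l _ _ N); lia).
  (* As [6 N <= b], one has [4 N b (x - c) <= 6 N (x + b) <= b (x + 6 N)]; dividing by [b] leaves
     the claim. *)
  destruct (Z_le_gt_dec (4 * N * (x - c)) (x + 6 * N)) as [|G]; [lia|exfalso].
  assert (b * (x + 6 * N + 1) <= b * (4 * N * (x - c)))
    by (apply Z.mul_le_mono_nonneg_l; lia).
  assert (2 * N * (2 * (b * (x - c))) <= 2 * N * (3 * (x + b)))
    by (apply Z.mul_le_mono_nonneg_l; lia).
  assert (6 * N * x <= b * x) by (apply Z.mul_le_mono_nonneg_r; lia).
  lia.
Qed.

(** * The place where two rays meet *)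

Lemma first_common_ancestor par p q w :
  anc par p w -> anc par q w ->
  exists n m, Nat.iter n par p = Nat.iter m par q /\
    anc par (Nat.iter n par p) w /\
    (forall i, (i < n)%nat -> ~ anc par q (Nat.iter i par p)) /\
    (forall j, (j < m)%nat -> Nat.iter j par q <> Nat.iter n par p).
Proof.
  intros [k Hk] Hqw.
  destruct (least_nat (fun i => anc par q (Nat.iter i par p))) as [n [Hn Hmin]];
    [now exists k; rewrite Hk|].
  (* An arbitrary [par] may revisit vertices, so the first arrival from [q] is chosen as well. *)
  destruct (least_nat (fun j => Nat.iter j par q = Nat.iter n par p)) as [m [Hm Hm']];
    [exact Hn|].
  exists n, m; repeat split; auto.
  rewrite <- Hk; apply anc_iter_le.
  destruct (Nat.le_gt_cases n k) as [|Hlt]; [easy|].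
  exfalso; apply (Hmin k Hlt); now rewrite Hk.
Qed.

(* Just above the first common vertex the two branches would have to fit, together with each other or with
   that vertex, into one column; a column only has room for two descendants of a vertical edge. *)
Lemma no_common_vertex N par h p q w :
  ray_tree N par -> 1 <= N -> 0 <= h -> 0 <= fst p -> 0 <= fst q ->
  snd p = h -> snd q = h -> anc par p w -> anc par q w ->
  6 * N + 1 <= snd w -> 2 * N * (h + 2) + 1 < fst w ->
  (forall z, anc par p z -> anc par q z -> snd z <> h /\
     forall v, anc par p v \/ anc par q v -> snd v = snd z ->
       fst v <= fst p /\ fst v <= fst q) ->
  False.
Proof.
  intros HT HN Hh Hp0 Hq0 Hp Hq Hpw Hqw Hwy Hwx Hfar.
  destruct (first_common_ancestor par p q w Hpw Hqw) as [n [m [Hnm [Hzw [Hn Hm]]]]].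
  set (z := Nat.iter n par p) in *.
  assert (Hpz : anc par p z) by apply anc_iter.
  assert (Hqz : anc par q z) by (rewrite Hnm; apply anc_iter).
  destruct (Hfar z Hpz Hqz) as [Hzh Hcol].
  destruct (Hcol z (or_introl Hpz) eq_refl) as [Hzp Hzq].
  pose proof HT as [_ [Hroot Hcl]].
  assert (Hpr : forall v, anc par p v -> -1 <= snd v <= h + 1)
    by (intros v Hv; destruct (Hcl p v Hv) as [_ [_ H]]; lia).
  assert (Hqr : forall v, anc par q v -> -1 <= snd v <= h + 1)
    by (intros v Hv; destruct (Hcl q v Hv) as [_ [_ H]]; lia).
  assert (HNh : 0 <= 2 * N * h) by (apply Z.mul_nonneg_nonneg; lia).
  (* An ancestor exceeds its descendant by at most one in either coordinate here, so [z] has height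
     at least [6 N] and abscissa above [2 N (h + 2)]; hence the extra [1] in the hypotheses on
     [w]. *)
  destruct (Hcl z w Hzw) as [_ [Hwx' Hwy']].
  (* To reach the root, the walk from [z] leaves its row by a vertical step [e], [e'], up or down;
     this edge is common to both rays. *)
  destruct (Hroot z) as [k0 Hk0].
  destruct (row_leave N par z k0 (snd z) HT eq_refl) as [k [_ [Hk1 [Hk2 Hk3]]]];
    [rewrite Hk0; cbn; lia|].
  set (e := Nat.iter k par z) in *; set (e' := Nat.iter (S k) par z) in *.
  set (c := fst e) in *; set (a := Z.min (snd e) (snd e')).
  assert (Hze : anc par z e) by apply anc_iter.
  assert (Hedge : below_edge par c a z).
  { assert (Ee : e = (c, snd e)) by (unfold c; now destruct e).
    assert (Ee' : e' = (c, snd e')) by (rewrite <- Hk3; now destruct e').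
    assert (Hze' : anc par z e') by apply anc_iter.
    assert (D : (a = snd e /\ a + 1 = snd e') \/ (a = snd e' /\ a + 1 = snd e)) by lia.
    destruct D as [[D1 D2]|[D1 D2]]; split; rewrite ?D2, ?D1, <- ?Ee, <- ?Ee'; auto. }
  (* Since [v] and [e] share a row, the edge is close enough to the column of [v] for that column to
     hold only two of its descendants. *)
  assert (Hshort : forall v, anc par v z -> snd v = snd z -> fst z <= fst v ->
            0 <= c /\ 4 * N * fst v <= 4 * N * c + fst v + 6 * N).
  { intros v Hv Hvy Hvx.
    assert (H : 4 * N * fst v <= 4 * N * c + fst v + 6 * N).
    { apply (row_run_short N par (fst v) (snd z) c); auto; try lia.
      replace (fst v, snd z) with v by (rewrite <- Hvy; now destruct v).
      replace (c, snd z) with e by (rewrite <- Hk1; now destruct e).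
      eapply anc_trans; eauto. }
    split; [|exact H].
    assert (0 < (4 * N - 1) * fst v - 6 * N) by nia.
    nia. }
  assert (Hin : forall v, anc par v z -> below_edge par c a v)
    by (intros v Hv; eapply below_edge_anc; eauto).
  assert (Hpi : forall i, (i <= n)%nat -> anc par (Nat.iter i par p) z)
    by (intros i Hi; now apply anc_iter_le).
  assert (Hqj : forall j, (j <= m)%nat -> anc par (Nat.iter j par q) z)
    by (intros j Hj; rewrite Hnm; now apply anc_iter_le).
  assert (Hpt : forall i, (i <= n)%nat ->
            -1 <= snd (Nat.iter i par p) <= h + 1 /\ below_edge par c a (Nat.iter i par p))
    by (intros i Hi; split; [apply Hpr, anc_iter | auto]).
  assert (Hqt : forall j, (j <= m)%nat ->
            -1 <= snd (Nat.iter j par q) <= h + 1 /\ below_edge par c a (Nat.iter j par q))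
    by (intros j Hj; split; [apply Hqr, anc_iter | auto]).
  assert (Hpq : forall i j, (i < n)%nat -> Nat.iter i par p <> Nat.iter j par q)
    by (intros i j Hi E; apply (Hn i Hi); rewrite E; apply anc_iter).
  destruct (row_enter N par p n (snd z) HT) as [i [Hi [Hi1 [Hi2 Hi3]]]];
    [congruence | easy |].
  destruct (row_enter N par q m (snd z) HT) as [j [Hj [Hj1 [Hj2 Hj3]]]];
    [congruence | now rewrite Hnm |].
  destruct (Hcol (Nat.iter (S i) par p)) as [_ Hiq]; [left; apply anc_iter | easy |].
  destruct (Hcol (Nat.iter (S j) par q)) as [Hjp _]; [right; apply anc_iter | easy |].
  destruct (Z_lt_le_dec (fst z) (fst (Nat.iter (S i) par p))) as [Hip|Hip].
  (* The walk from [p] enters the row of [z] to the right of [z]: that column holds both ends of the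
     entering step and a vertex of the other walk. *)
  - destruct (column_hit N par q m (fst (Nat.iter (S i) par p)) HT) as [l [Hl Hlx]];
      [rewrite <- Hnm; lia|].
    destruct (Hshort (Nat.iter (S i) par p)) as [Hc0 Hsh]; [apply Hpi; lia | easy | lia |].
    assert (Hin' : (S i < n)%nat).
    { destruct (Nat.eq_dec (S i) n) as [E|]; [|lia].
      rewrite E in Hip; fold z in Hip; lia. }
    apply (column_at_most_two N par c a (fst (Nat.iter (S i) par p)) h
             (Nat.iter i par p) (Nat.iter (S i) par p) (Nat.iter l par q)); auto; try lia.
    + intros r [<-|[<-|[<-|[]]]]; split; auto; try (apply Hpt; lia); apply Hqt; lia.
    + intros E; apply Hi1; now rewrite E.
  - destruct (Z_lt_le_dec (fst z) (fst (Nat.iter (S j) par q))) as [Hjq|Hjq].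
    + destruct (column_hit N par p n (fst (Nat.iter (S j) par q)) HT) as [l [Hl Hlx]];
        [fold z; lia|].
      destruct (Hshort (Nat.iter (S j) par q)) as [Hc0 Hsh]; [apply Hqj; lia | easy | lia |].
      assert (Hln : (l < n)%nat).
      { destruct (Nat.eq_dec l n) as [E|]; [|lia].
        rewrite E in Hlx; fold z in Hlx; lia. }
      apply (column_at_most_two N par c a (fst (Nat.iter (S j) par q)) h
               (Nat.iter l par p) (Nat.iter j par q) (Nat.iter (S j) par q)); auto; try lia.
      * intros r [<-|[<-|[<-|[]]]]; split; auto; try (apply Hqt; lia); apply Hpt; lia.
      * intros E; apply Hj1; now rewrite E.
    (* Both walks enter the row at or left of [z], so each has already met the column of [z] off
       that common vertex; with [z] this makes three. *)
    + destruct (column_hit N par p i (fst z) HT) as [k1 [Hk1' Hk1x]]; [lia|].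
      destruct (column_hit N par q j (fst z) HT) as [k2 [Hk2' Hk2x]]; [lia|].
      destruct (Hshort z) as [Hc0 Hsh]; [now exists 0%nat | easy | lia |].
      apply (column_at_most_two N par c a (fst z) h
               (Nat.iter k1 par p) (Nat.iter k2 par q) z); auto; try lia.
      * intros r [<-|[<-|[<-|[]]]]; split; auto; try (apply Hqt; lia); apply Hpt; lia.
      * apply Hpq; lia.
      * rewrite Hnm; apply Hpq; lia.
      * apply Hm; lia.
Qed.

(** * Many rays to one high row *)

Lemma pigeonhole (f : nat -> Z) (a : Z) (n : nat) :
  (forall i, (i <= n)%nat -> a <= f i < a + Z.of_nat n) ->
  exists i j, (i < j <= n)%nat /\ f i = f j.
Proof.
  intros H; apply NNPP; intros Hno.
  assert (ND : NoDup (map f (seq 0 (S n)))).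
  { apply NoDup_nth with (d := f 0%nat); intros i j Hi Hj E.
    rewrite length_map, length_seq in Hi, Hj.
    rewrite !map_nth, !seq_nth in E by lia; simpl in E.
    destruct (Nat.lt_trichotomy i j) as [L|[L|L]]; [|easy|];
      exfalso; apply Hno; [exists i, j | exists j, i]; split; auto; lia. }
  assert (IN : incl (map f (seq 0 (S n)))
                 (map (fun k => a + Z.of_nat k) (seq 0 n))).
  { intros y Hy; apply in_map_iff in Hy as [i [<- Hi]]; apply in_seq in Hi.
    specialize (H i ltac:(lia)).
    apply in_map_iff; exists (Z.to_nat (f i - a)); rewrite in_seq; lia. }
  pose proof (NoDup_incl_length ND IN) as L.
  rewrite !length_map, !length_seq in L; lia.
Qed.

(** The common factor [h] of the target's coordinates cancels, so the bound does not depend on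
    [h]. *)
Lemma far_ray N par h W x y :
  ray_tree N par -> 1 <= N -> 0 < h -> 0 <= W ->
  anc par (h * W, h) (x, y) -> 2 * Z.abs (y * W - x) <= 3 * (W + 1).
Proof.
  intros [_ [_ Hcl]] HN Hh HW Ha.
  destruct (Hcl _ _ Ha) as [E _]; cbn [fst snd] in E.
  replace (y * (h * W) - x * h) with (h * (y * W - x)) in E by ring.
  rewrite Z.abs_mul, !Z.abs_eq in E by nia.
  set (t := Z.abs (y * W - x)) in *; clearbody t.
  assert (H : 2 * N * (h * t) <= 3 * N * (h * (W + 1))) by nia.
  apply (Z.mul_le_mono_pos_l _ _ (N * h)); nia.
Qed.

(* With [B] large, the rays to the points [(h T u, h)], [n <= u < 2 n], cross the column [2 B n T] in at most
   [B + 3 < n] rows, although they can only share vertices far below the row [h]. *)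
Lemma no_ray_tree N par : 1 <= N -> ~ ray_tree N par.
Proof.
  intros HN HT; pose proof HT as [_ [Hroot Hcl]].
  (* [B] makes the crossing rows at least [6 N + 1], [n] exceeds the [B + 3] rows available, [h]
     stays far above the rows of common vertices, and [T] pushes the crossing column beyond
     [2 N (h + 2)]. *)
  assert (HB : exists B, 6 * N + 2 <= B) by (eexists; reflexivity); destruct HB as [B HB].
  assert (Hn : exists n, n = B + 4) by eauto; destruct Hn as [n Hn].
  assert (Hh : exists h, h = 20 * n) by eauto; destruct Hh as [h Hh].
  assert (HTT : exists T, 4 <= T /\ 2 * N * (h + 2) < T)
    by (exists (2 * N * (h + 2) + 4);
        pose proof (Z.mul_nonneg_nonneg (2 * N) (h + 2)); lia).
  destruct HTT as [T [HT4 HTN]].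
  set (P := fun u => (h * (T * u), h)).
  assert (HBT : 0 <= B * T) by (apply Z.mul_nonneg_nonneg; lia).
  assert (Hray : forall u x y, n <= u -> anc par (P u) (x, y) ->
            2 * Z.abs (y * (T * u) - x) <= 3 * (T * u + 1)).
  { intros u x y Hu Ha; apply (far_ray N par h); auto; try lia.
    apply Z.mul_nonneg_nonneg; lia. }
  (* Quantifying [r] before [n <= u] allows a total choice function; [0] is the default for smaller
     [u]. *)
  assert (Hhit : forall u, exists r, n <= u -> anc par (P u) (2 * B * n * T, r)).
  { intros u; destruct (Hroot (P u)) as [k Hk].
    destruct (Z_le_gt_dec n u) as [Hu|Hu]; [|exists 0; lia].
    destruct (column_hit N par (P u) k (2 * B * n * T) HT) as [l [_ Hl]].
    - rewrite Hk; unfold P; cbn [fst]; split;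
        [repeat apply Z.mul_nonneg_nonneg; lia|].
      replace (2 * B * n * T) with (2 * B * (T * n)) by ring.
      apply Z.mul_le_mono_nonneg; [lia | lia | apply Z.mul_nonneg_nonneg; lia |].
      apply Z.mul_le_mono_nonneg_l; lia.
    - exists (snd (Nat.iter l par (P u))); intros _; rewrite <- Hl.
      rewrite <- surjective_pairing; apply anc_iter. }
  (* The column lies between [B] and [2 B] times [T u], and [T u >= 4] makes the deviation
     [3/2 (1 + 1/(T u))] less than two rows. *)
  assert (Hrow : forall u r, n <= u < 2 * n -> anc par (P u) (2 * B * n * T, r) ->
            B - 1 <= r <= 2 * B + 1).
  { intros u r Hu Ha; pose proof (Hray u _ _ ltac:(lia) Ha) as E.
    assert (HW : T * 1 <= T * u) by (apply Z.mul_le_mono_nonneg_l; lia).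
    assert (H1 : 2 * (B * T) * n <= 2 * (B * T) * u)
      by (apply Z.mul_le_mono_nonneg_l; lia).
    assert (H2 : B * T * u <= B * T * (2 * n))
      by (apply Z.mul_le_mono_nonneg_l; lia).
    replace (2 * (B * T) * n) with (2 * B * n * T) in H1 by ring.
    replace (2 * (B * T) * u) with (2 * B * (T * u)) in H1 by ring.
    replace (B * T * (2 * n)) with (2 * B * n * T) in H2 by ring.
    replace (B * T * u) with (B * (T * u)) in H2 by ring.
    set (W := T * u) in *; set (X := 2 * B * n * T) in *; clearbody W X.
    split.
    - destruct (Z_le_gt_dec (B - 1) r) as [|G]; [easy|].
      assert (r * W <= (B - 2) * W) by (apply Z.mul_le_mono_nonneg_r; lia). lia.
    - destruct (Z_le_gt_dec r (2 * B + 1)) as [|G]; [easy|].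
      assert ((2 * B + 2) * W <= r * W) by (apply Z.mul_le_mono_nonneg_r; lia). lia. }
  destruct (functional_choice _ Hhit) as [r Hr].
  destruct (pigeonhole (fun m => r (n + Z.of_nat m)) (B - 1) (Z.to_nat (n - 1)))
    as [i [j [Hij Erow]]].
  { intros m Hm.
    assert (Hu : n <= n + Z.of_nat m < 2 * n) by lia.
    pose proof (Hrow _ _ Hu (Hr _ (proj1 Hu))); lia. }
  set (u := n + Z.of_nat i) in *; set (u' := n + Z.of_nat j) in *.
  assert (Hu : n <= u < 2 * n) by lia.
  assert (Hu' : n <= u' < 2 * n) by lia.
  assert (Huu : u + 1 <= u') by lia.
  pose proof (Hr u ltac:(lia)) as Hw; pose proof (Hr u' ltac:(lia)) as Hw'.
  rewrite <- Erow in Hw'.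
  pose proof (Hrow u _ Hu Hw) as Hwr.
  clearbody u u'.
  apply (no_common_vertex N par h (P u) (P u') (2 * B * n * T, r u)); auto;
    unfold P in *; cbn [fst snd] in *; try lia;
    try (repeat apply Z.mul_nonneg_nonneg; lia).
  { assert (1 * T <= 2 * B * n * T); [|lia].
    apply Z.mul_le_mono_nonneg_r; [lia|].
    assert (1 * n <= 2 * B * n) by (apply Z.mul_le_mono_nonneg_r; lia); lia. }
  intros [x b] Hz Hz'; cbn [fst snd] in *.
  pose proof (Hray u _ _ ltac:(lia) Hz) as E.
  pose proof (Hray u' _ _ ltac:(lia) Hz') as E'.
  (* Subtracting the two bounds gives [b T (u' - u) <= 6 n T + 3], while [u' - u >= 1] and
     [T >= 4]. *)
  assert (Hb : b <= 6 * n).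
  { destruct (Z_le_gt_dec b (6 * n)) as [|G]; [easy|exfalso].
    assert (F1 : b * T * (u + 1) <= b * T * u')
      by (apply Z.mul_le_mono_nonneg_l; [apply Z.mul_nonneg_nonneg|]; lia).
    assert (F2 : (6 * n + 1) * T <= b * T) by (apply Z.mul_le_mono_nonneg_r; lia).
    assert (F3 : T * (u + u') <= T * (4 * n)) by (apply Z.mul_le_mono_nonneg_l; lia).
    replace (b * (T * u)) with (b * T * u) in E by ring.
    replace (b * (T * u')) with (b * T * u') in E' by ring.
    lia. }
  split; [lia|].
  (* In row [b <= 6 n] the abscissa is at most [12 n^2 T + 3 n T + 3/2], which [h = 20 n] keeps
     below [h T n = 20 n^2 T]. *)
  assert (Hx : forall v w, n <= v < 2 * n -> anc par (P v) w -> snd w = b ->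
            fst w <= h * (T * n)).
  { intros v [y b'] Hv Hw0 Eb; cbn in Eb; subst b'.
    pose proof (Hray v _ _ ltac:(lia) Hw0) as F; cbn [fst].
    assert (F1 : b * (T * v) <= 6 * n * (T * v))
      by (apply Z.mul_le_mono_nonneg_r; [apply Z.mul_nonneg_nonneg|]; lia).
    assert (F2 : T * v <= T * (2 * n)) by (apply Z.mul_le_mono_nonneg_l; lia).
    assert (F3 : 6 * n * (T * v) <= 6 * n * (T * (2 * n)))
      by (apply Z.mul_le_mono_nonneg_l; lia).
    assert (F4 : 1 * n <= T * n) by (apply Z.mul_le_mono_nonneg_r; lia).
    assert (F5 : T * n * 12 <= T * n * n) by (apply Z.mul_le_mono_nonneg_l; lia).
    subst h; lia. }
  assert (Hm : forall v, n <= v -> h * (T * n) <= h * (T * v)) 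
    by (intros; apply Z.mul_le_mono_nonneg_l; [|apply Z.mul_le_mono_nonneg_l]; lia).
  intros w Hw0 Eb; pose proof (Hm u ltac:(lia)); pose proof (Hm u' ltac:(lia)).
  destruct Hw0 as [Hw0|Hw0];
    [pose proof (Hx u _ Hu Hw0 Eb) | pose proof (Hx u' _ Hu' Hw0 Eb)]; lia.
Qed.

(** * From a consistent ray system to a parent function *)

Lemma chain_parity l a d :
  chain l -> head l = Some a ->
  exists k, fst (last l d) + snd (last l d)
            = fst a + snd a + Z.of_nat (length l) - 1 + 2 * k.
Proof.
  revert a; induction l as [|x [|y t] IH]; intros a Hc Ha; [easy| |].
  - injection Ha as <-; exists 0; simpl; lia.
  - injection Ha as <-; destruct Hc as [Hxy Hc].
    destruct (IH y Hc eq_refl) as [k Hk].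
    change (last (x :: y :: t) d) with (last (y :: t) d).
    change (length (x :: y :: t)) with (S (length (y :: t))).
    unfold adj in Hxy; rewrite Hk.
    (* Each grid step flips the parity of the coordinate sum. *)
    assert (D : fst y + snd y = fst x + snd x + 1 \/ fst y + snd y = fst x + snd x - 1) by lia.
    destruct D; [exists k | exists (k - 1)]; lia.
Qed.

Lemma chain_app_r l1 l2 : chain (l1 ++ l2) -> chain l2.
Proof.
  induction l1 as [|x l1 IH]; [easy|].
  cbn; destruct (l1 ++ l2); [intros _; now apply IH | intros H; now apply IH].
Qed.

Lemma path_predecessor l o p :
  is_path l o p -> p <> o -> exists q, In q l /\ adj q p.
Proof.
  intros [_ [Hc [Hh [Hl Hne]]]] Hpo.
  destruct (exists_last Hne) as [l1 [x ->]]; rewrite last_last in Hl; subst x.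
  destruct l1 as [|y l1]; [injection Hh as <-; now contradict Hpo|].
  destruct (exists_last (l := y :: l1)) as [l2 [q E]]; [easy|].
  rewrite E, <- app_assoc in *; exists q; split; [apply in_or_app; simpl; auto|].
  apply chain_app_r in Hc; apply Hc.
Qed.

Lemma path_end l o p : is_path l o p -> In p l.
Proof.
  intros [_ [_ [_ [<- Hne]]]].
  destruct (exists_last Hne) as [l1 [x ->]]; rewrite last_last.
  apply in_or_app; simpl; auto.
Qed.

(* By (S3) the ray of the predecessor [q] of [p] is contained in that of [p]; the two sets have sizes of
   opposite parity, so the inclusion is strict. *)
Lemma parent_function o R :
  S1 o R -> S3 R ->
  exists par : pt -> pt,
    (forall p, Z.abs (fst (par p) - fst p) + Z.abs (snd (par p) - snd p) <= 1) /\
    (forall p, exists n, Nat.iter n par p = o) /\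
    (forall p v, anc par p v -> R p v).
Proof.
  intros H1 H3; destruct (functional_choice _ H1) as [f Hf].
  assert (Hex : forall p, exists q,
            Z.abs (fst q - fst p) + Z.abs (snd q - snd p) <= 1 /\ R p q /\
            (p <> o -> (length (f q) < length (f p))%nat)).
  { intros p; destruct (Hf p) as [Hp Hin].
    destruct (classic (p = o)) as [E|Hpo].
    - exists p; split; [lia|]; split; [|easy].
      apply Hin; eapply path_end; eauto.
    - destruct (path_predecessor _ _ _ Hp Hpo) as [q [Hq Hadj]].
      exists q; unfold adj in Hadj; split; [lia|]; split; [now apply Hin|]; intros _.
      destruct (Hf q) as [Hq' Hin'].
      assert (Hle : (length (f q) <= length (f p))%nat).
      { apply NoDup_incl_length; [apply Hq'|].
        intros v Hv; apply Hin; apply Hin in Hq; apply (H3 p q Hq); now apply Hin'. }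
      destruct Hp as [_ [Hc [Hh [Hl _]]]], Hq' as [_ [Hc' [Hh' [Hl' _]]]].
      destruct (chain_parity _ _ o Hc Hh) as [k Hk], (chain_parity _ _ o Hc' Hh') as [k' Hk'].
      rewrite Hl in Hk; rewrite Hl' in Hk'; lia. }
  destruct (functional_choice _ Hex) as [par Hpar]; exists par; split; [|split].
  - intros p; apply Hpar.
  - intros p; remember (length (f p)) as k eqn:Ek; revert p Ek.
    induction k as [k IH] using lt_wf_ind; intros p ->.
    destruct (classic (p = o)) as [->|Hpo]; [now exists 0%nat|].
    destruct (Hpar p) as [_ [_ Hlt]].
    destruct (IH _ (Hlt Hpo) (par p) eq_refl) as [n Hn].
    exists (S n); now rewrite Nat.iter_succ_r.
  - intros p v [n <-]; revert p; induction n as [|n IH]; intros p.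
    + destruct (Hf p) as [Hp Hin]; apply Hin; eapply path_end; eauto.
    + rewrite Nat.iter_succ_r; destruct (Hpar p) as [_ [Hq _]].
      exact (H3 p (par p) Hq _ (IH (par p))).
Qed.

Open Scope R_scope.

(** * From the suprema to bounds on single vertices *)

Lemma linf_to_seg_pt_ge0 o p v t : 0 <= linf_to_seg_pt o p v t.
Proof.
  unfold linf_to_seg_pt; eapply Rle_trans; [|apply Rmax_l]; apply Rabs_pos.
Qed.

(** [seg_error] collects only finite distances, so finiteness comes before any use of a vertex; the
    same holds for [sys_error] and segments. *)
Lemma dist_seg_finite o p v :
  exists d, dist_seg o p v = Finite d /\ d <= linf_to_seg_pt o p v 0.
Proof.
  unfold dist_seg.
  destruct (Glb_Rbar_correct (fun d => exists t, 0 <= t <= 1 /\ d = linf_to_seg_pt o p v t))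
    as [Hlb Hglb].
  set (g := Glb_Rbar _) in *.
  assert (H0 : Rbar_le (Finite 0) g).
  { apply Hglb; intros d [t [_ ->]]; apply linf_to_seg_pt_ge0. }
  assert (H1 : Rbar_le g (Finite (linf_to_seg_pt o p v 0))).
  { apply Hlb; exists 0; split; [lra | easy]. }
  destruct g as [d| |]; [now exists d | easy | easy].
Qed.

Lemma seg_error_finite o R p :
  S1 o R -> exists e, seg_error o R p = Finite e.
Proof.
  intros H1; destruct (H1 p) as [l [Hl Hin]].
  assert (HM : exists M, forall v, In v l -> linf_to_seg_pt o p v 0 <= M).
  { clear; induction l as [|x l [M HM]]; [now exists 0|].
    exists (Rmax M (linf_to_seg_pt o p x 0)); intros v [->|Hv]; [apply Rmax_r|].
    eapply Rle_trans; [now apply HM | apply Rmax_l]. }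
  destruct HM as [M HM].
  unfold seg_error.
  destruct (Lub_Rbar_correct (fun d => exists v, R p v /\ dist_seg o p v = Finite d))
    as [Hub Hlub].
  set (g := Lub_Rbar _) in *.
  assert (H0 : Rbar_le g (Finite M)).
  { apply Hlub; intros d [v [Hv Hd]].
    destruct (dist_seg_finite o p v) as [d' [Ed' Hd']].
    rewrite Hd in Ed'; injection Ed' as <-.
    eapply Rle_trans; [exact Hd' | apply HM, Hin, Hv]. }
  destruct (dist_seg_finite o p p) as [d [Ed _]].
  assert (H2 : Rbar_le (Finite d) g).
  { apply Hub; exists p; split; [apply Hin; eapply path_end; eauto | easy]. }
  destruct g as [e| |]; [now exists e | easy | easy].
Qed.

(** The slack [E < E'] avoids showing that the infimum over the segment is attained. *)
Lemma ray_near_segment o R E E' :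
  S1 o R -> Rbar_le (sys_error o R) (Finite E) -> E < E' ->
  forall p v, R p v -> exists t, 0 <= t <= 1 /\ linf_to_seg_pt o p v t <= E'.
Proof.
  intros H1 Hsys HE p v Hv.
  destruct (seg_error_finite o R p H1) as [e He].
  destruct (dist_seg_finite o p v) as [d [Hd _]].
  assert (HeE : e <= E).
  { change (Rbar_le (Finite e) (Finite E)); eapply Rbar_le_trans; [|exact Hsys].
    unfold sys_error; apply Lub_Rbar_correct; now exists p. }
  assert (Hde : d <= e).
  { change (Rbar_le (Finite d) (Finite e)); rewrite <- He.
    unfold seg_error; apply Lub_Rbar_correct; now exists v. }
  apply NNPP; intros Hno.
  assert (Rbar_le (Finite E') (dist_seg o p v)) as Hlow.
  { unfold dist_seg; apply Glb_Rbar_correct; intros r [t [Ht ->]]; simpl.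
    destruct (Rle_lt_dec E' (linf_to_seg_pt o p v t)) as [|Hlt]; [easy|].
    exfalso; apply Hno; exists t; split; [easy | lra]. }
  rewrite Hd in Hlow; simpl in Hlow; lra.
Qed.

(** * Translation of the root to the origin, and conclusion *)

Definition shift (o p : pt) : pt := ((fst p + fst o)%Z, (snd p + snd o)%Z).
Definition unshift (o p : pt) : pt := ((fst p - fst o)%Z, (snd p - snd o)%Z).

Lemma shift_unshift o p : shift o (unshift o p) = p.
Proof. destruct p; unfold shift, unshift; cbn [fst snd]; f_equal; lia. Qed.

Lemma unshift_iter o par n p :
  Nat.iter n (fun q => unshift o (par (shift o q))) p = unshift o (Nat.iter n par (shift o p)).
Proof.
  induction n as [|n IH]; simpl.
  - destruct p; unfold shift, unshift; cbn [fst snd]; f_equal; lia.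
  - now rewrite IH, shift_unshift.
Qed.

(** In the cross product of [v] and [p], relative to [o], the point at parameter [t] cancels,
    leaving at most [E (|s| + |h|)]. The other bounds round by integrality, since [E < 2]. *)
Lemma close_of_near N E o p v t :
  (1 <= N)%Z -> E < 3/2 -> IZR N * (2 * E) <= 3 * IZR N - 2 -> 0 <= t <= 1 ->
  linf_to_seg_pt o (shift o p) v t <= E -> close N p (unshift o v).
Proof.
  intros HN HE HNE Ht H; unfold linf_to_seg_pt in H.
  destruct p as [s h]; unfold close, shift, unshift in *; cbn [fst snd] in *.
  set (x := (fst v - fst o)%Z); set (y := (snd v - snd o)%Z).
  assert (Hx : Rabs (IZR x - t * IZR s) <= E).
  { eapply Rle_trans; [|exact H]; eapply Rle_trans; [|apply Rmax_l].
    right; f_equal; unfold x; rewrite plus_IZR, minus_IZR; ring. }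
  assert (Hy : Rabs (IZR y - t * IZR h) <= E).
  { eapply Rle_trans; [|exact H]; eapply Rle_trans; [|apply Rmax_r].
    right; f_equal; unfold y; rewrite plus_IZR, minus_IZR; ring. }
  clearbody x y; clear H.
  split; [|split].
  - apply le_IZR; rewrite !mult_IZR, minus_IZR, plus_IZR, mult_IZR, !abs_IZR, minus_IZR, !mult_IZR.
    replace (IZR y * IZR s - IZR x * IZR h) with
      ((IZR y - t * IZR h) * IZR s - (IZR x - t * IZR s) * IZR h) by ring.
    set (A := IZR y - t * IZR h) in *; set (B := IZR x - t * IZR s) in *.
    pose proof (Rabs_triang (A * IZR s) (- (B * IZR h))) as Htri.
    rewrite Rabs_Ropp, !Rabs_mult in Htri.
    pose proof (Rabs_pos (IZR s)) as Hs; pose proof (Rabs_pos (IZR h)) as Hh.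
    apply IZR_le in HN.
    assert (HA : Rabs A * Rabs (IZR s) <= E * Rabs (IZR s)) by now apply Rmult_le_compat_r.
    assert (HB : Rabs B * Rabs (IZR h) <= E * Rabs (IZR h)) by now apply Rmult_le_compat_r.
    apply Rle_trans with (2 * IZR N * (E * (Rabs (IZR s) + Rabs (IZR h)))).
    + apply Rmult_le_compat_l; [lra | unfold Rminus; lra].
    + replace (2 * IZR N * (E * (Rabs (IZR s) + Rabs (IZR h)))) with
        (IZR N * (2 * E) * (Rabs (IZR s) + Rabs (IZR h))) by ring.
      apply Rmult_le_compat_r; lra.
  - apply Rabs_le_between in Hx.
    assert (t * IZR s <= IZR (Z.max s 0)).
    { destruct (Z.max_spec s 0) as [[C ->]|[C ->]]; apply IZR_le in C || apply IZR_lt in C; nra. }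
    enough (x < Z.max s 0 + 2)%Z by lia.
    apply lt_IZR; rewrite plus_IZR; lra.
  - apply Rabs_le_between in Hy.
    assert (t * IZR h <= IZR (Z.max h 0)).
    { destruct (Z.max_spec h 0) as [[C ->]|[C ->]]; apply IZR_le in C || apply IZR_lt in C; nra. }
    assert (IZR (Z.min h 0) <= t * IZR h).
    { destruct (Z.min_spec h 0) as [[C ->]|[C ->]]; apply IZR_le in C || apply IZR_lt in C; nra. }
    enough (Z.min h 0 - 2 < y < Z.max h 0 + 2)%Z by lia.
    split; apply lt_IZR; rewrite ?plus_IZR, ?minus_IZR; lra.
Qed.

Theorem theorem2 : forall (eps : R), 0 < eps ->
  forall (o : pt) (Ro : ray_system),
    WCDR o Ro -> ~ Rbar_le (sys_error o Ro) (Finite (3/2 - eps)).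
Proof.
  intros eps Heps o Ro [H1 [H3 _]] Hsys.
  destruct (parent_function o Ro H1 H3) as [par [Hstep [Hroot Hanc]]].
  (* Half of [eps] is given up as slack for [ray_near_segment]; then [2 E = 3 - eps <= 3 - 2 / N]
     once [N >= 2 / eps]. *)
  set (E := 3/2 - eps / 2).
  set (N := up (2 / eps)).
  assert (HN : 2 / eps < IZR N) by apply archimed.
  assert (Hpos : 0 < 2 / eps) by (apply Rdiv_lt_0_compat; lra).
  assert (HN1 : (1 <= N)%Z).
  { enough (0 < N)%Z by lia; apply lt_IZR; lra. }
  assert (HNE : IZR N * (2 * E) <= 3 * IZR N - 2).
  { assert (2 <= IZR N * eps); [|unfold E; lra].
    apply Rmult_lt_compat_r with (r := eps) in HN; [|easy].
    replace (2 / eps * eps) with 2 in HN by (field; lra); lra. }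
  apply (no_ray_tree N (fun q => unshift o (par (shift o q))) HN1).
  split; [|split].
  - intros p; specialize (Hstep (shift o p)).
    unfold shift, unshift in *; cbn [fst snd] in *; lia.
  - intros p; destruct (Hroot (shift o p)) as [n Hn].
    exists n; rewrite unshift_iter, Hn; unfold unshift; f_equal; lia.
  - intros p v [n <-]; rewrite unshift_iter.
    destruct (ray_near_segment o Ro _ E H1 Hsys) with
      (p := shift o p) (v := Nat.iter n par (shift o p)) as [t [Ht Hd]].
    + unfold E; lra.
    + apply Hanc, anc_iter.
    + apply (close_of_near N E o p _ t); auto; unfold E; lra.
Qed.
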